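(* Let $P$ be a proposition about numbers $x \in *G$. If there is a finite $x_0 > 0$ such that $P(x)$ holds for all $x \in *G$ with $-x_0 < x < x_0$, then the condition can be transferred to the infinitely small domain, $(\forall x : -x_0 < x < x_0) \mapsto (x \in \Phi)$; that is, $P(x)$ holds for all $x \in \Phi$.
   Context: $*G$ denotes the gossamer number system: numbers built from the finite integers together with infinite integers (integers larger in magnitude than every finite integer) in the same way that the reals are built from the integers. It is taken to be a totally ordered field containing the ordered field $\mathbb{R}$ as a subfield and containing infinite numbers. A number in $*G$ is a positive (negative) infinite number, or infinity, if it is larger (smaller) than every real number. $\Phi^{-1}$ is the set of all infinities. $\Phi = \{x \in *G\setminus\{0\}: 1/x \in \Phi^{-1}\}$ is the set of infinitesimals. The infinireals are $\mathbb{R}_\infty = \Phi \cup \Phi^{-1}$. A number is finite (bounded) if it lies in $*G \setminus \mathbb{R}_\infty$ (a real number, or a non-zero real plus an infinitesimal). An implicit infinite condition at the infinitely small is a condition ''$\forall x : |x| < x_0$'' with $x_0$ finite, whose domain contains both finite numbers and infinireals. *)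

(* Defs.v *)
From HB Require Import structures.
From mathcomp Require Import all_boot all_order all_algebra.
From mathcomp Require Import classical_sets reals.

Set Implicit Arguments.
Unset Strict Implicit.
Unset Printing Implicit Defensive.

Import Order.TTheory GRing.Theory Num.Theory.
Local Open Scope classical_set_scope.
Local Open Scope ring_scope.

(* The gossamer numbers *G enter only as a totally ordered field that contains
   the reals as an ordered subfield (via [real_emb]) and has infinite numbers. *)
Record gossamer (R : realType) := Gossamer {
  gossamer_field :> realFieldType;
  real_emb : {rmorphism R -> gossamer_field};
  real_emb_mono : {mono real_emb : r s / r <= s};
  gossamer_infinite : exists w : gossamer_field,
    (forall r : R, real_emb r < w) \/ (forall r : R, w < real_emb r)
}.

Arguments real_emb {R} g.

Section GossamerSets.
Variables (R : realType) (G : gossamer R).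

Definition pos_infinity (x : G) : Prop := forall r : R, real_emb G r < x.

Definition neg_infinity (x : G) : Prop := forall r : R, x < real_emb G r.

Definition infinities : set G := [set x | pos_infinity x \/ neg_infinity x].

Definition infinitesimals : set G := [set x | x != 0 /\ infinities (1 / x)].

Definition infinireals : set G := infinitesimals `|` infinities.

(* 0 is finite: it is not an infinitesimal by definition. *)
Definition finite_numbers : set G := ~` infinireals.

End GossamerSets.

Arguments infinities {R} G.
Arguments infinitesimals {R} G.
Arguments infinireals {R} G.
Arguments finite_numbers {R} G.

(* Main.v *)
(* An infinitesimal x with |x| >= x0 > 0 would make 1/x0 >= |1/x| larger than
   every real, so that x0 itself would be an infinitesimal and not finite. *)

Require Import Defs.
From HB Require Import structures.
From mathcomp Require Import all_boot all_order all_algebra.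
From mathcomp Require Import classical_sets reals.

Set Implicit Arguments.
Unset Strict Implicit.
Unset Printing Implicit Defensive.

Import Order.TTheory GRing.Theory Num.Theory.
Local Open Scope classical_set_scope.
Local Open Scope ring_scope.

(** The infinitesimals all lie inside (-x0, x0): by [infinitesimal_lt], each is smaller in absolute
    value than any positive number that is not infinitesimal, and a finite x0 is such a number. *)

Lemma infinities_norm (R : realType) (G : gossamer R) (x : G) :
  infinities G x -> pos_infinity `|x|.
Proof.
move=> [x_pos|x_neg] r; first exact: lt_le_trans (x_pos r) (ler_norm x).
(* As x lies below the image of [- r], its opposite lies above that of [r]. *)
by rewrite -normrN (lt_le_trans _ (ler_norm _)) // ltrNr -rmorphN.
Qed.

Lemma infinitesimal_lt (R : realType) (G : gossamer R) (x y : G) :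
  infinitesimals G x -> 0 < y -> ~ infinitesimals G y -> `|x| < y.
Proof.
move=> [x_neq0 x_inf] y_gt0 y_ninf; rewrite ltNge; apply/negP => le_yx.
apply: y_ninf; split; first by rewrite gt_eqF.
(* Inverting y <= |x| between positive numbers gives |1/x| <= 1/y, so 1/y is a positive infinity
   too. *)
left=> r; apply: lt_le_trans (infinities_norm x_inf r) _.
by rewrite !div1r normfV lef_pV2 // posrE normr_gt0.
Qed.

Theorem theorem4p2 (R : realType) (G : gossamer R) (P : G -> Prop) :
  (exists x0 : G, [/\ finite_numbers G x0, 0 < x0 &
     forall x : G, - x0 < x < x0 -> P x]) ->
  forall x : G, infinitesimals G x -> P x.
Proof.
move=> [x0 [x0_fin x0_gt0 Px]] x x_inf; apply: Px.
by rewrite -ltr_norml infinitesimal_lt // => x0_inf; apply: x0_fin; left.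
Qed.
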